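(* For all $n\ge 1$ the following identities hold: \begin{enumerate} \item $\displaystyle\sum_{\sigma\in\mathcal{I}_{4n}(321)}(-1)^{\mathrm{maj}(\sigma)}q^{\mathrm{lead}(\sigma)}=\frac{1}{q}\sum_{\sigma\in\mathcal{I}_{2n}(321)}q^{2\,\mathrm{lead}(\sigma)}$; \item $\displaystyle\sum_{\sigma\in\mathcal{I}_{4n+2}(321)}(-1)^{\mathrm{maj}(\sigma)}q^{\mathrm{lead}(\sigma)}=\Big(\frac{1}{q}-1\Big)\sum_{\sigma\in\mathcal{I}_{2n+1}(321)}q^{2\,\mathrm{lead}(\sigma)}$; \item $\displaystyle\sum_{\sigma\in\mathcal{I}_{4n+3}(321)}(-1)^{\mathrm{maj}(\sigma)}q^{\mathrm{lead}(\sigma)}=\Big(\frac{2}{q}-1\Big)\sum_{\sigma\in\mathcal{I}_{2n+1}(321)}q^{2\,\mathrm{lead}(\sigma)}$; \item $\displaystyle\sum_{\sigma\in\mathcal{I}_{4n+1}(321)}(-1)^{\mathrm{maj}(\sigma)}q^{\mathrm{lead}(\sigma)}=\Big(\frac{1}{q}-1\Big)\sum_{\sigma\in\mathcal{I}_{2n+1}(321)}q^{2\,\mathrm{lead}(\sigma)}+\sum_{\sigma\in\mathcal{I}_{2n}(321)}q^{2\,\mathrm{lead}(\sigma)}$. \end{enumerate}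
   Context: $\mathcal{I}_m(321)$ is the set of involutions $\sigma=\sigma_1\cdots\sigma_m$ of $\{1,\dots,m\}$ (one-line notation) with no decreasing subsequence of length three. $\mathrm{Des}(\sigma)=\{i:1\le i\le m-1,\ \sigma_i>\sigma_{i+1}\}$, $\mathrm{maj}(\sigma)=\sum_{i\in\mathrm{Des}(\sigma)}i$, and $\mathrm{lead}(\sigma)=\sigma_1$. *)

(* Defs.v *)
From mathcomp Require Import all_boot all_fingroup all_algebra.

Set Implicit Arguments.
Unset Strict Implicit.
Unset Printing Implicit Defensive.

(* A permutation s : 'S_m acts on {0, ..., m-1}; its one-line notation
   s_1 ... s_m is over {1, ..., m}, so both positions and values are shifted. *)
Definition one_line (m : nat) (s : 'S_m) : seq nat :=
  [seq (s i : nat).+1 | i <- enum 'I_m].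

(* Meaningful for 1 <= i <= m. *)
Definition entry (m : nat) (s : 'S_m) (i : nat) : nat :=
  nth 0 (one_line s) i.-1.

Definition Des (m : nat) (s : 'S_m) : seq nat :=
  [seq i <- iota 1 m.-1 | entry s i > entry s i.+1].

Definition maj (m : nat) (s : 'S_m) : nat := \sum_(i <- Des s) i.

Definition lead (m : nat) (s : 'S_m) : nat := entry s 1.

(* The identity counts as an involution. *)
Definition is_involution (m : nat) (s : 'S_m) : bool :=
  [forall i : 'I_m, s (s i) == i].

Definition avoids321 (m : nat) (s : 'S_m) : bool :=
  ~~ [exists i : 'I_m, exists j : 'I_m, exists k : 'I_m,
        [&& i < j, j < k, s i > s j & s j > s k]].

Definition I321 (m : nat) : {set 'S_m} :=
  [set s | is_involution s && avoids321 s].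

(* Main.v *)
(* Encode s in I321 m by its excedance word, whose i-th letter tells whether
   i < s i. In a 321-avoiding involution the arcs i < s i are non-nesting and
   cover no fixed point, so these words are exactly those whose walk, with steps
   +1 and -1 (the latter truncated at 0), goes from 0 to 0. The descents of s are
   the factors 10 of the word, and lead s is the position of the first 0.
   Reading letters in pairs, (-1)^maj is the product over the pairs of -1 for 10
   and +1 otherwise; at positive height the pairs 10 and 01 cancel, so the signed
   sums satisfy, at half the height and half the length, the recurrence of the
   unsigned ones. *)
Require Import Defs.
From mathcomp Require Import all_boot all_fingroup all_algebra.
From mathcomp Require Import ring zify.
Import GRing.Theory.

Set Implicit Arguments.
Unset Strict Implicit.
Unset Printing Implicit Defensive.

(** * The excedance word of a 321-avoiding involution *)

(* Encodes at once the arcs of an involution and its fixed points: a letter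
   false closes an arc at positive height and is a fixed point at height 0. *)
Definition reflected_step (h : nat) (up : bool) : nat := if up then h.+1 else h.-1.

Definition exc_word (m : nat) (s : 'S_m) : seq bool :=
  [seq i < s i | i : 'I_m].

Lemma size_exc_word m (s : 'S_m) : size (exc_word s) = m.
Proof. by rewrite size_map -cardE card_ord. Qed.

Lemma nth_exc_word m (s : 'S_m) (i : 'I_m) : nth false (exc_word s) i = (i < s i).
Proof. by rewrite (nth_map i) ?size_enum_ord // nth_ord_enum. Qed.

Lemma I321P m (s : 'S_m) :
  reflect ((forall i, s (s i) = i) /\
           (forall i j k : 'I_m, i < j -> j < k -> s j < s i -> s k < s j -> False))
          (s \in I321 m).
Proof.
rewrite inE; apply: (iffP andP) => -[inv av]; split.
- by move=> i; apply/eqP; move/forallP: inv.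
- move=> i j k ij jk sij sjk; move/existsP: av; apply.
  by exists i; apply/existsP; exists j; apply/existsP; exists k; apply/and4P.
- by apply/forallP => i; apply/eqP.
- apply/existsP => -[i /existsP[j /existsP[k /and4P[ij jk sij sjk]]]].
  exact: av ij jk sij sjk.
Qed.

Lemma exc_word_inj m : {in I321 m &, injective (@exc_word m)}.
Proof.
move=> s t /I321P[invs avs] /I321P[invt avt] Est.
have exc_eq (i : 'I_m) : (i < s i) = (i < t i) by rewrite -!nth_exc_word Est.
(* At the first difference i, say with i < u i < v i, the entries of v at i,
   u i and v i form a 321 pattern. *)
have no_first_diff (u v : 'S_m) (i : 'I_m) :
    (forall i : 'I_m, u (u i) = i) -> (forall i : 'I_m, v (v i) = i) ->
    (forall i j k : 'I_m, i < j -> j < k -> v j < v i -> v k < v j -> False) ->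
    (forall i : 'I_m, (i < u i) = (i < v i)) ->
    (forall l : 'I_m, l < i -> u l = v l) -> i <= u i -> u i < v i -> False.
  move=> invu invv avv uv agree iu uvi.
  have i_u : i < u i by rewrite uv; lia.
  have vui : v (u i) <= u i by rewrite leqNgt -uv invu -leqNgt ltnW.
  apply: (avv i (u i) (v i)) => //; first by lia.
  rewrite invv; case: ltngtP => // [lt|eq].
    by move: (agree _ lt); rewrite invv => /perm_inj E; move: lt; rewrite E ltnn.
  by move: uvi; rewrite [in v i](val_inj eq) invv ltnn.
apply/permP => i.
have [n] := ubnP (nat_of_ord i); elim: n i => // n IHn i /ltnSE le_in.
have agree (l : 'I_m) : l < i -> s l = t l by move=> li; apply: IHn; lia.
(* If [s i < i] then [t] agrees with [s] at [s i], so it sends [s i] back to [i]; only values at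
   least [i] need the pattern argument. *)
have [si|si] := ltnP (s i) i.
  by apply: (@perm_inj _ t); rewrite invt -agree ?invs.
have [ti|ti] := ltnP (t i) i.
  by apply: (@perm_inj _ s); rewrite invs agree ?invt.
apply: val_inj; case: (ltngtP (s i) (t i)) => // [lt|lt]; exfalso.
  exact: (no_first_diff s t i).
by apply: (no_first_diff t s i) => // l /agree.
Qed.

(* The height before position i is the number of arcs crossing the gap there. *)
Lemma height_exc_word m (s : 'S_m) i : s \in I321 m -> i <= m ->
  foldl reflected_step 0 (take i (exc_word s))
    = #|[set j : 'I_m | (j < i) && (i <= s j)]|.
Proof.
move=> /I321P[inv av].
elim: i => [|i IHi] im.
  by rewrite take0 /=; apply/esym/eqP; rewrite cards_eq0; apply/eqP/setP => j; rewrite !inE.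
rewrite (take_nth false) ?size_exc_word // foldl_rcons IHi; last exact: ltnW.
rewrite /reflected_step.
have [o oE ->] : exists2 o : 'I_m, o = i :> nat & nth false (exc_word s) i = (o < s o).
  by exists (Ordinal im); rewrite -?nth_exc_word.
subst i.
case: ltngtP => [ltio|gtio|eqio].
- rewrite -[LHS]add1n (cardsD1 o [set j : 'I_m | (j < o.+1) && _]) inE ltio ltnSn.
  congr (_ + _); apply: eq_card => j; rewrite !inE -val_eqE /= ltnS.
  have [eqj|neqj] := eqVneq (s j : nat) o.
    suff -> : (j : nat) = s o by lia.
    by rewrite -[j]inv (val_inj eqj).
  by move: neqj; lia.
- rewrite (cardsD1 (s o) [set j : 'I_m | (j < o) && _]) inE inv gtio leqnn /=.
  apply: eq_card => j; rewrite !inE -val_eqE /=.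
  have [eqj|neqj] := eqVneq (s j : nat) o.
    suff -> : (j : nat) = s o by lia.
    by rewrite -[j]inv (val_inj eqj).
  have : (j : nat) != s o by apply: contraNN neqj => /eqP/val_inj->; rewrite inv.
  have [->|] := eqVneq j o; first by lia.
  by rewrite -val_eqE /=; move: neqj; lia.
(* A fixed point under an arc would be the middle of a 321 pattern, so no arc crosses either gap and
   the truncated step stays at 0. *)
- rewrite !eq_card0 // => j; rewrite !inE; apply/negbTE/negP => /andP[ji isj].
    have [eqj|neqj] := eqVneq (j : nat) o.
      by move: isj; rewrite (val_inj eqj) -eqio; lia.
    apply: (av j o (s j)); rewrite ?inv -?eqio; lia.
  have : s j != s o by rewrite (inj_eq perm_inj) -val_eqE /=; lia.
  rewrite -val_eqE /= -eqio => neq.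
  by apply: (av j o (s j)); rewrite ?inv -?eqio /=; lia.
Qed.

Lemma exc_word_height0 m (s : 'S_m) : s \in I321 m ->
  foldl reflected_step 0 (exc_word s) = 0.
Proof.
move=> Is; have := height_exc_word Is (leqnn m).
rewrite take_oversize ?size_exc_word // => ->.
by apply: eq_card0 => j; rewrite !inE [m <= _]leqNgt (ltn_ord (s j)) andbF.
Qed.

Lemma entryE m (s : 'S_m) (i : 'I_m) : entry s i.+1 = (s i).+1.
Proof. by rewrite /entry /one_line (nth_map i) ?size_enum_ord //= nth_ord_enum. Qed.

(** A position [j] before [s o] with letter false would give a 321 pattern at [o], [j], [s o]. *)
Lemma lead_exc_word m (s : 'S_m) : s \in I321 m -> 0 < m ->
  lead s = (index false (exc_word s)).+1.
Proof.
move=> /I321P[inv av] m_gt0; pose o := Ordinal m_gt0.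
rewrite /lead (entryE s o); congr _.+1.
have nth_so : nth false (exc_word s) (s o) = false by rewrite nth_exc_word inv.
have before j : j < s o -> nth false (exc_word s) j.
  move=> jso; have jm : j < m by apply: ltn_trans jso _.
  rewrite (nth_exc_word s (Ordinal jm)) /= ltnNge; apply/negP => sjj.
  have j_gt0 : 0 < j.
    by case: (posnP j) => // j0; move: sjj; rewrite (_ : Ordinal jm = o) ?j0; [lia|exact: val_inj].
  apply: (av o (Ordinal jm) (s o)) => //=; first by lia.
  rewrite inv /= lt0n; apply: contraTneq jso => sj0.
  have <- : s (Ordinal jm) = o by exact: val_inj.
  by rewrite inv ltnn.
have so_lt : s o < size (exc_word s) by rewrite size_exc_word ltn_ord.
case: (ltngtP (index false (exc_word s)) (s o)) => // [lt|gt].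
- have := before _ lt; rewrite nth_index //.
  by rewrite -index_mem; apply: ltn_trans so_lt.
- by move: (before_find false gt); rewrite nth_so.
Qed.

(** At a descent [x], [y], a letter false at [x] gives a 321 pattern at [s y], [x], [y], and a
    letter true at [y] gives one at [x], [y], [s y]. *)
Lemma descent_exc_word m (s : 'S_m) (i : nat) : s \in I321 m -> i.+1 < m ->
  (entry s i.+2 < entry s i.+1)
    = nth false (exc_word s) i && ~~ nth false (exc_word s) i.+1.
Proof.
move=> /I321P[inv av] im1; have im := ltnW im1.
pose x := Ordinal im; pose y := Ordinal im1.
have xE : x = i :> nat by []; have yE : y = i.+1 :> nat by [].
rewrite (entryE s x) (entryE s y) (nth_exc_word s x) (nth_exc_word s y) ltnS.
have sxy : (s x : nat) <> s y by move=> /val_inj/perm_inj/(congr1 val)/= /n_Sn.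
apply/idP/andP => [syx|[]]; last by lia.
split; rewrite ltnNge; apply/negP => le.
  by apply: (av (s y) x y); rewrite ?inv; lia.
by apply: (av x y (s y)); rewrite ?inv; lia.
Qed.

(** * Every word returning to height 0 is an excedance word *)

Definition count_below (P : pred nat) (x : nat) : nat := count P (iota 0 x).

Lemma count_belowS P x : count_below P x.+1 = count_below P x + P x.
Proof. by rewrite /count_below -addn1 iotaD count_cat /= add0n addn0. Qed.

Lemma leq_count_below P x y : x <= y -> count_below P x <= count_below P y.
Proof. by move/subnKC <-; rewrite /count_below iotaD count_cat leq_addr. Qed.

Lemma ltn_count_below (P : pred nat) x y :
  P x -> x < y -> count_below P x < count_below P y.
Proof. by move=> Px /(leq_count_below P); rewrite count_belowS Px addn1. Qed.

Lemma ltn_count_belowW P x y : count_below P x < count_below P y -> x < y.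
Proof. by rewrite !ltnNge; apply: contra => /(leq_count_below P). Qed.

Lemma count_below_inj (P : pred nat) x y :
  P x -> P y -> count_below P x = count_below P y -> x = y.
Proof.
move=> Px Py eq; case: (ltngtP x y) => // [/(ltn_count_below Px)|/(ltn_count_below Py)];
  by rewrite eq ltnn.
Qed.

Lemma count_below_onto (P : pred nat) n c : c < count_below P n ->
  exists x, [/\ x < n, P x & count_below P x = c].
Proof.
elim: n => [|n IHn] //; rewrite count_belowS.
have [/IHn[x [xn Px xc]] _|le_c] := ltnP c (count_below P n).
  by exists x; split=> //; apply: ltnW.
by move=> lt_c; exists n; split=> //; move: le_c lt_c; case: (P n); lia.
Qed.

Definition height (w : seq bool) (i : nat) : nat :=
  foldl reflected_step 0 (take i w).

Definition opens (w : seq bool) : pred nat := fun i => nth false w i.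

Definition closes (w : seq bool) : pred nat :=
  fun i => ~~ nth false w i && (0 < height w i).

Lemma count_opens w i : i <= size w ->
  count_below (opens w) i = count_below (closes w) i + height w i.
Proof.
elim: i => [|i IHi] iw; first by rewrite /height take0.
have hS : height w i.+1 = reflected_step (height w i) (opens w i).
  by rewrite /height (take_nth false iw) foldl_rcons.
rewrite !count_belowS hS IHi ?(ltnW iw) // /closes -/(opens w i) /reflected_step.
by case: (opens w i) => /=; case: (height w i); lia.
Qed.

(** The involution joins the opening and the closing of equal rank, first in, first out, so that
    arcs do not nest. Ending at height 0 makes openings and closings equally many. *)
Lemma exc_word_onto m w : size w = m -> foldl reflected_step 0 w = 0 ->
  exists2 s : 'S_m, s \in I321 m & exc_word s = w.
Proof.
move=> sz_w end_w.
pose u := count_below (opens w); pose d := count_below (closes w).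
have ud x : x <= m -> u x = d x + height w x by rewrite -sz_w; apply: count_opens.
have udm : u m = d m by rewrite ud // /height take_oversize ?sz_w // end_w addn0.
pose partner (p r : 'I_m) :=
  if opens w p then closes w r && (d r == u p)
  else if closes w p then opens w r && (u r == d p) else r == p.
have [f fP] : exists f : 'I_m -> 'I_m, forall p, partner p (f p).
  apply: (@fin_all_exists _ (fun _ => 'I_m) partner) => p; rewrite /partner.
  have [Up|_] := boolP (opens w p).
    have : u p < d m by rewrite -udm; apply: ltn_count_below.
    by case/count_below_onto=> x [xm Dx xc]; exists (Ordinal xm); rewrite Dx; apply/eqP.
  have [Dp|_] := boolP (closes w p); last by exists p.
  have : d p < u m by rewrite udm; apply: ltn_count_below.
  by case/count_below_onto=> x [xm Ux xc]; exists (Ordinal xm); rewrite Ux; apply/eqP.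
have notUD x : opens w x -> closes w x -> False by rewrite /opens /closes => ->.
have fU (p : 'I_m) : opens w p -> closes w (f p) /\ d (f p) = u p.
  by have := fP p; rewrite /partner; case: ifP => // _ /andP[-> /eqP->].
have fD (p : 'I_m) : closes w p -> opens w (f p) /\ u (f p) = d p.
  have := fP p; rewrite /partner; case: ifP => [/notUD no _ /no//|_].
  by case: ifP => // _ /andP[-> /eqP->].
have fF (p : 'I_m) : ~~ opens w p -> ~~ closes w p -> f p = p /\ u p = d p.
  move=> nU nD; have := fP p; rewrite /partner (negbTE nU) (negbTE nD) => /eqP fp.
  split=> //; rewrite ud ?(ltnW (ltn_ord p)) //.
  by move: nU nD; rewrite /opens /closes => -> /=; case: height; lia.
have inv p : f (f p) = p.
  apply: val_inj; have [Up|nU] := boolP (opens w p).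
    have [Dfp e] := fU p Up; have [Uffp e'] := fD _ Dfp.
    by apply: (count_below_inj Uffp Up); rewrite -/u e' e.
  have [Dp|nD] := boolP (closes w p); last by have [e _] := fF p nU nD; rewrite !e.
  have [Ufp e] := fD p Dp; have [Dffp e'] := fU _ Ufp.
  by apply: (count_below_inj Dffp Dp); rewrite -/d e' e.
have ltU (p : 'I_m) : opens w p -> p < f p.
  move=> Up; have [Dfp e] := fU p Up; rewrite ltnNge leq_eqVlt; apply/norP; split.
    by apply/eqP => E; apply: (notUD p) => //; rewrite -E.
  (* A closing before [p] has rank below [d p], which is at most [u p]. *)
  apply/negP => /(ltn_count_below Dfp); rewrite -/d e ud; last exact: ltnW.
  lia.
have ltD (p : 'I_m) : closes w p -> f p < p.
  by move=> /fD[/ltU + _]; rewrite inv.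
(* Two opening positions, two closing positions or two fixed points are never
   inverted, and no fixed point lies under an arc. *)
have inversion (x y : 'I_m) : x < y -> f y < f x -> opens w x /\ closes w y.
  move=> xy fyx.
  have uW a b : u a < u b -> a < b by apply: ltn_count_belowW.
  have dW a b : d a < d b -> a < b by apply: ltn_count_belowW.
  have uS a : opens w a -> a < y -> u a < u y by apply: ltn_count_below.
  have dS a b : closes w a -> a < b -> d a < d b by apply: ltn_count_below.
  have [Ux|nUx] := boolP (opens w x).
    have [_ ex] := fU x Ux; have ux := uS _ Ux xy.
    have [Uy|nUy] := boolP (opens w y).
      have [_ ey] := fU y Uy; have := dW (f x) (f y); lia.
    have [//|nDy] := boolP (closes w y).
    by have [ey udy] := fF y nUy nDy; have := dW (f x) y; rewrite ey in fyx; lia.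
  have [Dx|nDx] := boolP (closes w x).
    have [_ ex] := fD x Dx; have ltx := ltD x Dx.
    have [Uy|nUy] := boolP (opens w y); first by have := ltU y Uy; lia.
    have [Dy|nDy] := boolP (closes w y).
      have [_ ey] := fD y Dy; have := uW (f x) (f y); have := dS x y Dx xy; lia.
    by have [ey _] := fF y nUy nDy; rewrite ey in fyx; lia.
  have [ex udx] := fF x nUx nDx; rewrite ex in fyx.
  have [Uy|nUy] := boolP (opens w y); first by have := ltU y Uy; lia.
  have [Dy|nDy] := boolP (closes w y); last by have [ey _] := fF y nUy nDy; rewrite ey in fyx; lia.
  have [Ufy ey] := fD y Dy.
  have : u (f y) < u x by apply: ltn_count_below.
  have : d x <= d y by apply/leq_count_below/ltnW.
  lia.
have f_inj : injective f by apply: can_inj inv.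
exists (perm f_inj).
  apply/I321P; split=> [i|i j k ij jk]; rewrite !permE // => fji fkj.
  (* The middle of a 321 pattern would both close and open. *)
  by have [_ Dj] := inversion i j ij fji; have [Uj _] := inversion j k jk fkj; exact: notUD Uj Dj.
apply: (@eq_from_nth _ false); rewrite size_exc_word // => i im.
rewrite (nth_exc_word _ (Ordinal im)) permE -/(opens w i).
have [Ui|nUi] := boolP (opens w i); first exact: ltU.
have [Di|nDi] := boolP (closes w i); first by rewrite ltnNge ltnW // ltD.
by have [-> _] := fF (Ordinal im) nUi nDi; rewrite ltnn.
Qed.

(** * Signed enumeration of the words *)

Local Open Scope ring_scope.

Fixpoint walks (h m : nat) : seq (seq bool) :=
  if m is m'.+1 then
    map (cons true) (walks h.+1 m') ++ map (cons false) (walks h.-1 m')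
  else if h == 0%N then [:: [::]] else [::].

Lemma mem_map_cons (T : eqType) (x y : T) (s : seq T) (ss : seq (seq T)) :
  (x :: s \in map (cons y) ss) = (x == y) && (s \in ss).
Proof.
apply/mapP/andP => [[t tss [-> ->]]|[/eqP-> sss]]; last by exists s.
by rewrite eqxx.
Qed.

Lemma mem_walks h m w :
  (w \in walks h m) = (size w == m) && (foldl reflected_step h w == 0%N).
Proof.
elim: m h w => [|m IHm] h w /=.
  by case: w => [|b w] /=; case: eqP => //= _; rewrite inE.
rewrite mem_cat; case: w => [|b w].
  by apply/norP; split; apply/mapP => -[].
by rewrite !mem_map_cons !IHm eqSS; case: b; rewrite ?orbF.
Qed.

Lemma uniq_walks h m : uniq (walks h m).
Proof.
elim: m h => [|m IHm] h /=; first by case: eqP.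
rewrite cat_uniq !map_inj_uniq ?IHm /= ?andbT; try by move=> x y [].
by apply/hasPn => _ /mapP[x _ ->]; apply/mapP => -[].
Qed.

Lemma sum_walksS (R : nmodType) (F : seq bool -> R) h m :
  \sum_(w <- walks h m.+1) F w
    = \sum_(w <- walks h.+1 m) F (true :: w)
      + \sum_(w <- walks h.-1 m) F (false :: w).
Proof. by rewrite /= big_cat !big_map. Qed.

(* In 1-based indexing only descents at odd positions affect the parity of maj,
   and these lie inside the consecutive pairs of letters. *)
Fixpoint pair_sign (R : pzRingType) (w : seq bool) : R :=
  if w is a :: b :: w' then (-1) ^+ (a && ~~ b) * pair_sign R w' else 1.

Definition signed_count (R : pzRingType) (h m : nat) : R :=
  \sum_(w <- walks h m) pair_sign R w.

Definition walk_count (R : pzRingType) (h k : nat) : R :=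
  \sum_(w <- walks h k) 1.

Definition signed_run_gf (R : pzRingType) (q : R) (h m : nat) : R :=
  \sum_(w <- walks h m) pair_sign R w * q ^+ index false w.

Definition run_gf (R : pzRingType) (q : R) (h k : nat) : R :=
  \sum_(w <- walks h k) q ^+ (2 * index false w).

(** * Recurrences comparing signed and unsigned sums *)

Section Transfer.

Context (R : comPzRingType) (q : R).

Local Notation A := (signed_count R).
Local Notation B := (walk_count R).
Local Notation U := (signed_run_gf q).
Local Notation V := (run_gf q).

(** The terms come from the leading pairs 11, 10, 01, 00. At [h = 0] it is 10 and 00 that cancel,
    and 01 leads to height 1, whose half is 0: the truncated step of the halved walk. *)
Lemma signed_countSS h m :
  A h m.+2 = A h.+2 m - A h m + A h.-1.+1 m + A h.-2 m.
Proof.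
rewrite /signed_count !sum_walksS /=.
do 4 rewrite -?mulr_sumr ?expr0 ?expr1.
by ring.
Qed.

Lemma walk_countS h k : B h k.+1 = B h.+1 k + B h.-1 k.
Proof. by rewrite /walk_count sum_walksS. Qed.

(** Only the pair 11 prolongs the initial run; after the others just a signed count remains. *)
Lemma signed_run_gfSS h m :
  U h m.+2 = q ^+ 2 * U h.+2 m - q * A h m + A h.-1.+1 m + A h.-2 m.
Proof.
rewrite /signed_run_gf /signed_count !sum_walksS /=.
rewrite !mulr_sumr -sumrN !addrA; congr (_ + _ + _ + _);
  by apply: eq_bigr => w _; rewrite ?expr0 ?expr1 ?exprS; ring.
Qed.

Lemma run_gfS h k : V h k.+1 = q ^+ 2 * V h.+1 k + B h.-1 k.
Proof.
rewrite /run_gf /walk_count sum_walksS mulr_sumr; congr (_ + _).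
by apply: eq_bigr => w _; rewrite /= mulnS exprD.
Qed.

(** Both sides expand into terms equal by induction; at the bottom, the step down from 1 and the
    truncated step from 0 both land at 0. *)
Lemma walk_count_plateau h k : odd (h + k) -> B h.+1 k = B h k.
Proof.
elim: k h => [|k IHk] h.
  by case: h => // h _; rewrite /walk_count !big_nil.
rewrite addnS !walk_countS /= => hk; rewrite IHk //; congr (_ + _).
by case: h hk => //= h; rewrite negbK => hk; rewrite IHk.
Qed.

(** The pairs that survive cancellation preserve the parity of [h + h./2 + k], which is even at the
    end of a walk. *)
Lemma signed_count_even h k :
  A h k.*2 = if odd (h + h./2 + k) then 0 else B h./2 k.
Proof.
elim: k h => [|k IHk] h.
  rewrite /signed_count /walk_count.
  by case: h => [|[|h]]; rewrite ?big_seq1 ?big_nil ?if_same.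
rewrite doubleS signed_countSS !IHk walk_countS.
case: h => [|[|h]] /=.
- by rewrite !oddD /=; case: (odd k); rewrite /=; ring.
- by rewrite !oddD /=; case: (odd k); rewrite /=; ring.
- by rewrite !oddD /=; do 3 case: odd; rewrite /=; ring.
Qed.

(** The unpaired last letter can finish from height 0 or 1, one for each parity class, so no case
    vanishes. *)
Lemma signed_count_odd h k : A h k.*2.+1 = B h./2 k.
Proof.
elim: k h => [|k IHk] h.
  rewrite /signed_count /walk_count.
  by case: h => [|[|[|h]]]; rewrite /= ?big_seq1 ?big_nil.
rewrite doubleS signed_countSS !IHk walk_countS.
by case: h => [|[|h]] /=; ring.
Qed.

(** At this parity the only signed count left is the one matching [B j.-1 k] in [run_gfS]. *)
Lemma signed_run_gf_even_same j k :
  ~~ odd (j + k) -> U j.*2 k.*2 = V j k.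
Proof.
elim: k j => [|k IHk] j.
  by case: j => [|j] _; rewrite /signed_run_gf /run_gf ?big_seq1 ?big_nil ?mul1r.
rewrite addnS /= negbK doubleS signed_run_gfSS run_gfS -doubleS => jk.
rewrite IHk ?addSn /= ?jk // !signed_count_even.
case: j jk => [|j]; rewrite ?doubleS /= ?doubleK ?uphalf_double !oddD /= ?odd_double.
  by move=> -> /=; ring.
by case: (odd j); case: (odd k) => //= _; ring.
Qed.

(** Here the signed counts leave [(1 - q) * B j k], and the plateau turns [B j k] into
    [B j.-1 k]. *)
Lemma signed_run_gf_even_diff j k :
  odd (j + k) -> U j.*2 k.*2 = (1 - q) * V j k.
Proof.
elim: k j => [|k IHk] j.
  by case: j => // j _; rewrite /signed_run_gf /run_gf !big_nil mulr0.
rewrite addnS doubleS signed_run_gfSS run_gfS -doubleS => jk.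
rewrite IHk ?addSn //= !signed_count_even.
case: j jk => [|j]; rewrite ?doubleS /= ?doubleK ?uphalf_double.
  by rewrite !oddD /= => /negbTE -> /=; ring.
rewrite /= negbK => jk; rewrite (walk_count_plateau jk); move: jk.
by rewrite !oddD /= odd_double; case: (odd j); case: (odd k) => //= _; ring.
Qed.

Lemma signed_run_gf_odd_diff j k :
  odd (j + k) -> U j.*2 k.*2.+1 = (2 - q) * V j k.
Proof.
elim: k j => [|k IHk] j.
  by case: j => // j _; rewrite /signed_run_gf /run_gf !big_nil mulr0.
rewrite addnS doubleS signed_run_gfSS run_gfS -doubleS => jk.
rewrite IHk ?addSn //= !signed_count_odd.
case: j jk => [|j]; rewrite ?doubleS /= ?doubleK ?uphalf_double.
  by move=> _; ring.
by rewrite /= negbK => jk; rewrite (walk_count_plateau jk); ring.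
Qed.

Lemma signed_run_gf_odd_same j k : ~~ odd (j + k) -> (0 < j + k)%N ->
  U j.*2 k.*2.+1 = (1 - q) * V j k.+1 + q * V j k.
Proof.
elim: k j => [|k IHk] j.
  case: j => [|[|j]] // _ _; rewrite run_gfS /signed_run_gf /run_gf /walk_count.
  by rewrite !big_nil; ring.
rewrite addnS /= negbK doubleS signed_run_gfSS (run_gfS j k.+1) (run_gfS j k) -doubleS => jk _.
(* Expanding [B j.-1 k.+1] brings all counts to length [k], where the plateau identifies the
   adjacent heights that remain. *)
rewrite IHk ?addSn /= ?jk // !signed_count_odd (walk_countS j.-1 k).
case: j jk => [|[|j]] jk; rewrite ?doubleS /= ?doubleK ?uphalf_double.
- by rewrite (walk_count_plateau jk); ring.
- by ring.
- by rewrite (@walk_count_plateau j); [ring | move: jk; rewrite !addSn /= negbK].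
Qed.

End Transfer.

(* The default letter true keeps the last position from counting as a descent. *)
Lemma prod_descents_pair_sign (R : pzRingType) (w : seq bool) :
  \prod_(0 <= i < size w | nth true w i && ~~ nth true w i.+1) (-1) ^+ i.+1
    = pair_sign R w.
Proof.
have [n] := ubnP (size w); elim: n w => // n IHn [|a [|b w]] /= lt_w.
- by rewrite big_nil.
- by rewrite big_mkcond big_nat1 /= andbF.
rewrite big_mkcond 2?big_nat_recl //= -IHn; last by rewrite -ltnS ltnW.
rewrite [X in _ = _ * X]big_mkcond expr1 sqrrN expr1n if_same mul1r.
congr (_ * _); first by case: (a && ~~ b).
by apply: eq_bigr => i _; rewrite !exprS !mulN1r opprK.
Qed.

(** * Passing from involutions to words *)

Lemma sign_maj (R : pzRingType) m (s : 'S_m) : s \in I321 m ->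
  (-1) ^+ maj s = pair_sign R (exc_word s).
Proof.
move=> Is; rewrite -prod_descents_pair_sign size_exc_word /maj -prodrXr big_filter.
case: m s Is => [|m] s Is; first by rewrite !big_nil.
rewrite [RHS]big_mkcond big_nat_recr //= [nth _ _ m.+1]nth_default ?size_exc_word //.
have iotaE : iota 1 m = index_iota 1 m.+1 by rewrite /index_iota subn1.
rewrite andbF mulr1 iotaE big_add1 big_mkcond.
apply: eq_big_nat => i /= im.
by rewrite descent_exc_word // !(set_nth_default false true) ?size_exc_word // ltnW.
Qed.

Lemma perm_exc_words m :
  perm_eq [seq exc_word s | s <- enum (I321 m)] (walks 0 m).
Proof.
apply: uniq_perm; last first.
- move=> w; rewrite mem_walks; apply/mapP/andP => [[s]|[/eqP szw /eqP endw]].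
    by rewrite mem_enum => Is ->; rewrite size_exc_word exc_word_height0 ?eqxx.
  by have [s Is <-] := exc_word_onto szw endw; exists s; rewrite ?mem_enum.
- exact: uniq_walks.
- rewrite map_inj_in_uniq ?enum_uniq // => s t; rewrite !mem_enum.
  exact: exc_word_inj.
Qed.

Lemma sum_I321 (R : nmodType) m (F : seq bool -> R) :
  \sum_(s in I321 m) F (exc_word s) = \sum_(w <- walks 0 m) F w.
Proof. by rewrite -(perm_big _ (perm_exc_words m)) big_map big_enum. Qed.

Lemma sum_sign_lead (R : comPzRingType) (q : R) m : (0 < m)%N ->
  \sum_(s in I321 m) (-1) ^+ maj s * q ^+ lead s = q * signed_run_gf q 0 m.
Proof.
move=> m_gt0; rewrite /signed_run_gf -sum_I321 mulr_sumr.
apply: eq_bigr => s Is; rewrite (sign_maj R Is) lead_exc_word // exprS.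
by rewrite mulrCA.
Qed.

Lemma sum_lead2 (R : comPzRingType) (q : R) m : (0 < m)%N ->
  \sum_(s in I321 m) q ^+ (2 * lead s) = q ^+ 2 * run_gf q 0 m.
Proof.
move=> m_gt0; rewrite /run_gf -sum_I321 mulr_sumr.
by apply: eq_bigr => s Is; rewrite lead_exc_word // mulnS exprD.
Qed.

(* q is any unit of any commutative ring; the formal identities are the case
   of the indeterminate q over the integers. *)
Theorem theorem1p5 (R : comUnitRingType) (q : R) (n : nat)
    (hq : q \is a GRing.unit) (hn : (1 <= n)%N) :
  [/\ \sum_(s in I321 (4 * n)) (-1) ^+ maj s * q ^+ lead s
        = q^-1 * \sum_(s in I321 (2 * n)) q ^+ (2 * lead s),
      \sum_(s in I321 (4 * n + 2)) (-1) ^+ maj s * q ^+ lead s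
        = (q^-1 - 1) * \sum_(s in I321 (2 * n + 1)) q ^+ (2 * lead s),
      \sum_(s in I321 (4 * n + 3)) (-1) ^+ maj s * q ^+ lead s
        = (2 / q - 1) * \sum_(s in I321 (2 * n + 1)) q ^+ (2 * lead s)
    & \sum_(s in I321 (4 * n + 1)) (-1) ^+ maj s * q ^+ lead s
        = (q^-1 - 1) * \sum_(s in I321 (2 * n + 1)) q ^+ (2 * lead s)
          + \sum_(s in I321 (2 * n)) q ^+ (2 * lead s)].
Proof.
(* [sum_sign_lead] extracts [q] and [sum_lead2] extracts [q ^+ 2]; the factor [q^-1] balances
   them. *)
have qVq x : q^-1 * (q ^+ 2 * x) = q * x by rewrite mulrA expr2 mulKr.
have odd2n : odd (2 * n) = false by rewrite oddM.
rewrite !sum_sign_lead ?sum_lead2; try lia.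
(* Each length becomes a half length, [2 * n] or [2 * n + 1], whose parity selects the recurrence
   lemma at height 0. *)
have -> : (4 * n = (2 * n).*2)%N by lia.
have -> : ((2 * n).*2 + 2 = (2 * n + 1).*2)%N by lia.
have -> : ((2 * n).*2 + 3 = (2 * n + 1).*2.+1)%N by lia.
have -> : ((2 * n).*2 + 1 = (2 * n).*2.+1)%N by lia.
have -> : (2 * n + 1 = (2 * n).+1)%N by lia.
split.
- by rewrite (@signed_run_gf_even_same _ q 0) ?odd2n // qVq.
- by rewrite (@signed_run_gf_even_diff _ q 0) /= ?odd2n // [in RHS]mulrBl qVq; ring.
- by rewrite (@signed_run_gf_odd_diff _ q 0) /= ?odd2n // [in RHS]mulrBl -mulrA qVq; ring.
- rewrite (@signed_run_gf_odd_same _ q 0) /= ?odd2n //; last by lia.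
  by rewrite [in RHS]mulrBl qVq; ring.
Qed.
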